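(* Consider the problem of optimizing (minimizing, or maximizing) the ratio $h(S)=f(S)/g(S)$ over subsets $S\subseteq E$, where $f,g:2^{E}\to\mathbb{R}^{+}$ are two supermodular functions accessed through value queries. If $f$ and $g$ are both monotone non-decreasing, or if $f$ and $g$ are both monotone non-increasing, then no polynomial time algorithm can achieve a bounded approximation ratio for this problem; more precisely, no bounded approximation ratio can be achieved via a number of queries polynomial in $n=|E|$. This holds for each of the two monotonicity cases and for both minimization and maximization.
   Context: $E$ is a finite ground set of size $n$, and $\mathbb{R}^{+}$ denotes the nonnegative real numbers; the ratio $h(S)=f(S)/g(S)$ is considered at the sets $S$ with $g(S)\neq 0$. A set function $f:2^{E}\to\mathbb{R}^{+}$ is supermodular if $f(S)+f(T)\le f(S\cup T)+f(S\cap T)$ for all $S,T\subseteq E$. It is monotone non-decreasing if $f(S)\le f(T)$ whenever $S\subseteq T\subseteq E$, and monotone non-increasing if $f(S)\ge f(T)$ whenever $S\subseteq T\subseteq E$. An algorithm knows $E$ and learns about $f$ and $g$ only by querying sets $S\subseteq E$, receiving the values $f(S)$ and $g(S)$; at the end it returns a set. For $\rho\ge 1$, a returned set $S$ has approximation ratio $\rho$ for minimization if $h(S)\le\rho\cdot\min_{T}h(T)$, and for maximization if $h(S)\ge\frac{1}{\rho}\max_{T}h(T)$. A bounded approximation ratio means a finite factor $\rho$, possibly depending on $n$, that is guaranteed for all pairs $(f,g)$ of the given monotonicity type. *)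

(* Defs.v *)
From HB Require Import structures.
From mathcomp Require Import all_boot all_order all_algebra.
From mathcomp Require Import reals.

Set Implicit Arguments.
Unset Strict Implicit.
Unset Printing Implicit Defensive.

Import Order.TTheory GRing.Theory Num.Theory.
Local Open Scope ring_scope.

Variant monotonicity := Nondecreasing | Nonincreasing.
Variant objective := Minimize | Maximize.

Definition supermodular (R : realType) (E : finType) (f : {set E} -> R) : Prop :=
  forall S T : {set E}, f S + f T <= f (S :|: T) + f (S :&: T).

Definition monotone (R : realType) (E : finType) (m : monotonicity)
    (f : {set E} -> R) : Prop :=
  match m with
  | Nondecreasing => forall S T : {set E}, S \subset T -> f S <= f T
  | Nonincreasing => forall S T : {set E}, S \subset T -> f T <= f S
  end.

(* The last clause says that the ratio f / g is defined at some set: otherwise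
   there is no optimum to approximate. *)
Definition instance (R : realType) (E : finType) (m : monotonicity)
    (f g : {set E} -> R) : Prop :=
  [/\ forall S, 0 <= f S /\ 0 <= g S,
      supermodular f /\ supermodular g,
      monotone m f /\ monotone m g
    & exists S, g S != 0].

Definition ratio (R : realType) (E : finType) (f g : {set E} -> R)
    (S : {set E}) : R := f S / g S.

(* The optimum ranges over the sets T with g T != 0. The initial value of the
   iterated min / max is the ratio at S, itself one of the values ranged over
   because g S != 0, so it does not alter the optimum. *)
Definition approximates (R : realType) (E : finType) (o : objective) (rho : R)
    (f g : {set E} -> R) (S : {set E}) : Prop :=
  g S != 0 /\
  match o with
  | Minimize =>
      ratio f g S
        <= rho * \big[Num.min/ratio f g S]_(T | g T != 0) ratio f g T
  | Maximize =>
      rho^-1 * \big[Num.max/ratio f g S]_(T | g T != 0) ratio f g T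
        <= ratio f g S
  end.

(* A deterministic adaptive algorithm with value queries on a known ground set
   E: it either stops and returns a set, or queries a set S and continues
   according to the values f S and g S. The computation between queries is
   unrestricted. *)
Inductive algorithm (R : realType) (E : finType) : Type :=
| Return of {set E}
| Query of {set E} & (R -> R -> algorithm R E).

Fixpoint output (R : realType) (E : finType) (f g : {set E} -> R)
    (A : algorithm R E) : {set E} :=
  match A with
  | Return T => T
  | Query T next => output f g (next (f T) (g T))
  end.

Fixpoint query_count (R : realType) (E : finType) (f g : {set E} -> R)
    (A : algorithm R E) : nat :=
  match A with
  | Return _ => 0
  | Query T next => (query_count f g (next (f T) (g T))).+1
  end.

Definition polynomially_many_queries (R : realType) (m : monotonicity)
    (A : forall E : finType, algorithm R E) : Prop :=
  exists p : {poly nat}, forall (E : finType) (f g : {set E} -> R),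
    instance m f g -> (query_count f g (A E) <= p.[#|E|])%N.

Definition bounded_approximation_ratio (R : realType) (m : monotonicity)
    (o : objective) (A : forall E : finType, algorithm R E) : Prop :=
  exists rho : nat -> R, (forall n, 1 <= rho n) /\
    forall (E : finType) (f g : {set E} -> R),
      instance m f g -> approximates o (rho #|E|) f g (output f g (A E)).

(* Main.v *)
Require Import Defs.
From HB Require Import structures.
From mathcomp Require Import all_boot all_order all_algebra.
From mathcomp Require Import reals.
From mathcomp Require Import zify lra.

(** Hide a set [X] with [k] elements in a ground set of size [2k], and put
    [u S = max(|S| - k, 0) + [S = X]] and
    [v S = max(|S| - k + 1, 0) + rho * max(|S| - k, 0)].
    Both are supermodular and nondecreasing: the bump at [X] is absorbed by the
    kink of [max(|S| - k, 0)] at [|S| = k].  Moreover [u X = v X = 1], while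
    [(1 + rho) * u S <= v S] for every other [S], so only [X] is a
    [rho]-approximate minimizer of [v / u] or maximizer of [u / v].  An algorithm
    that never queries [X] behaves as if the bump were absent, and polynomially
    many queries cannot cover the ['C(2k, k) >= 2 ^ k] candidates for [X].
    Complementing all sets exchanges the two kinds of monotonicity. *)

Set Implicit Arguments.
Unset Strict Implicit.
Unset Printing Implicit Defensive.

Import Order.TTheory GRing.Theory Num.Theory.
Local Open Scope ring_scope.

(** * Central binomial coefficients outgrow polynomials *)

Lemma leq_exp2_central_bin k : (2 ^ k <= 'C(k.*2, k))%N.
Proof.
elim: k => [|k IHk]; first by rewrite bin0.
(* The two Pascal terms agree by symmetry, so the coefficient at least doubles. *)
rewrite doubleS binS -[in X in (_ + X)%N]bin_sub; last by lia.
have -> : (k.*2.+1 - k = k.+1)%N by lia.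
by rewrite binS expnS; lia.
Qed.

(** At powers of 2, a Horner step only adds [j] and a constant to the exponent. *)
Lemma poly_nat_exp2_bound (p : {poly nat}) :
  exists a b, forall j, (p.[(2 ^ j)%N]%R < 2 ^ (a + b * j))%N.
Proof.
elim/poly_ind: p => [|p c [a [b IHp]]].
  by exists 0%N, 0%N => j; rewrite horner0 expn_gt0.
exists (a + c).+1, b.+1 => j; rewrite hornerMXaddC.
have [lt_p lt_c] := (IHp j, ltn_expl c (ltnSn 1)).
have le_c : (2 ^ c <= 2 ^ (a + c + b.+1 * j))%N by rewrite leq_exp2l //; lia.
have le_p : (2 ^ (a + b * j + j) <= 2 ^ (a + c + b.+1 * j))%N.
  by rewrite leq_exp2l //; lia.
have lt_pX : (p.[(2 ^ j)%N]%R * 2 ^ j < 2 ^ (a + b * j + j))%N.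
  by rewrite expnD ltn_pmul2r // expn_gt0.
rewrite !addSn expnS.
change ((p.[(2 ^ j)%N]%R * 2 ^ j + c < 2 * 2 ^ (a + c + b.+1 * j))%N).
lia.
Qed.

(** The successor leaves room for the returned set beside the queried ones. *)
Lemma poly_nat_lt_central_bin (p : {poly nat}) :
  exists2 k, (0 < k)%N & ((p.[k.*2]%R).+1 < 'C(k.*2, k))%N.
Proof.
have [a [b ltp]] := poly_nat_exp2_bound p.
(* With [k = 2 ^ j] it suffices that [a + b * j.+1 < 2 ^ j]; here [2 ^ j] is the square of [2 ^ m],
   hence above [m * m], which dominates the left side. *)
pose m := (2 * (a + b)).+2; pose j := (2 * m)%N.
exists (2 ^ j)%N; first by rewrite expn_gt0.
apply: leq_trans (leq_exp2_central_bin _).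
rewrite -mul2n -expnS; apply: leq_ltn_trans (ltp j.+1) _.
rewrite ltn_exp2l // [in X in (_ < X)%N]/j expnM -mulnn expnMn.
have lt_m := ltn_expl m (ltnSn 1).
apply: leq_ltn_trans (ltn_mul lt_m lt_m).
by rewrite /j /m; nia.
Qed.

(** * Transcripts of queries *)

Section Queries.
Variables (R : realType) (E : finType).
Implicit Types (f g : {set E} -> R) (A : algorithm R E).

Fixpoint queries f g A : seq {set E} :=
  match A with
  | Return _ => [::]
  | Query T next => T :: queries f g (next (f T) (g T))
  end.

Lemma size_queries f g A : size (queries f g A) = query_count f g A.
Proof. by elim: A => //= T next IH; rewrite IH. Qed.

(** Equal answers select equal continuations, so agreement along the first run suffices. *)
Lemma eq_output f g f' g' A :
  {in queries f g A, f =1 f'} -> {in queries f g A, g =1 g'} ->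
  output f g A = output f' g' A.
Proof.
elim: A => //= T next IH eqf eqg.
rewrite -eqf ?mem_head // -eqg ?mem_head //.
by apply: IH => S S_in; [apply: eqf | apply: eqg]; rewrite inE S_in orbT.
Qed.

End Queries.

(** * Exchanging the monotonicity types by complementation *)

Section Orientation.
Variables (R : realType) (E : finType).
Implicit Types (m : monotonicity) (f g : {set E} -> R) (S T : {set E}).

Definition orient m S := if m is Nonincreasing then ~: S else S.

Lemma orientK m : involutive (orient m).
Proof. by case: m => S //=; rewrite setCK. Qed.

Lemma supermodular_orient m f :
  supermodular f -> supermodular (f \o orient m).
Proof.
by case: m => //= sf S T /=; rewrite setCU setCI [leRHS]addrC; apply: sf.
Qed.

Lemma monotone_orient m f :
  monotone Nondecreasing f -> monotone m (f \o orient m).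
Proof. by case: m => //= mf S T sST /=; apply: mf; rewrite setCS. Qed.

Lemma instance_orient m f g :
  instance Nondecreasing f g -> instance m (f \o orient m) (g \o orient m).
Proof.
case=> fg_ge0 [sf sg] [mf mg] [S gS]; split=> [T||| ].
- exact: fg_ge0.
- by split; apply: supermodular_orient.
- by split; apply: monotone_orient.
- by exists (orient m S); rewrite /= orientK.
Qed.

End Orientation.

(** * The hard instances *)

Section HardInstances.
Variables (R : realType) (E : finType) (k : nat) (rho : R).
Hypotheses (k_gt0 : (0 < k)%N) (ltkE : (k < #|E|)%N) (rho_ge1 : 1 <= rho).
Implicit Types (S T X : {set E}).

Let rho_gt0 : 0 < rho := lt_le_trans ltr01 rho_ge1.
Let rho_ge0 : 0 <= rho := ltW rho_gt0.

(** Subtraction in [nat] truncates, which supplies the maximum with 0. *)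
Definition excess t S : R := (#|S| - t)%:R.

Definition bumped X S : R := excess k S + (S == X)%:R.

Definition steep S : R := excess k.-1 S + rho * excess k S.

Lemma excess_ge0 t S : 0 <= excess t S.
Proof. exact: ler0n. Qed.

Lemma monotone_excess t : monotone Nondecreasing (excess t).
Proof. by move=> S T /subset_leq_card sST; rewrite ler_nat leq_sub2r. Qed.

(** A convex function of the cardinality is supermodular. *)
Lemma supermodular_excess t : supermodular (excess t).
Proof.
move=> S T; rewrite /excess -!natrD ler_nat.
have := cardsUI S T.
have := subset_leq_card (subsetUl S T).
have := subset_leq_card (subsetUr S T).
lia.
Qed.

Lemma monotone_bumped X : #|X| = k -> monotone Nondecreasing (bumped X).
Proof.
move=> cardX S T sST; rewrite /bumped /excess -!natrD ler_nat.
have [<-|neST] := eqVneq S T; first by [].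
have : S \proper T by rewrite properEneq neST.
move/proper_card; case: (S =P X) => [->|_]; rewrite ?cardX; lia.
Qed.

Lemma supermodular_bumped X : #|X| = k -> supermodular (bumped X).
Proof.
move=> cardX S T.
have [sST|nST] := boolP (S \subset T).
  by rewrite (setUidPr sST) (setIidPl sST) addrC.
have [sTS|nTS] := boolP (T \subset S).
  by rewrite (setUidPl sTS) (setIidPr sTS).
have lt_S : (#|S| < #|S :|: T|)%N.
  by rewrite proper_card // properE subsetUl subUset subxx.
have lt_T : (#|T| < #|S :|: T|)%N.
  by rewrite proper_card // properE subsetUr subUset subxx andbT.
have cardUI := cardsUI S T.
(* Incomparable sets are not both [X], so at most one bump occurs on the left; the strictly larger
   union pays for it. *)
have nXX : (S == X) && (T == X) = false.
  by apply/negP => /andP[/eqP eS /eqP eT]; rewrite eS eT subxx in nST.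
have SX : S == X -> #|S| = k by move/eqP->.
have TX : T == X -> #|T| = k by move/eqP->.
rewrite /bumped /excess -!natrD ler_nat.
move: nXX SX TX; case: (S == X); case: (T == X) => //= _;
  [move=> /(_ isT) ? _ | move=> _ /(_ isT) ? | move=> _ _]; lia.
Qed.

Lemma steep_ge0 S : 0 <= steep S.
Proof. by rewrite addr_ge0 ?mulr_ge0 ?excess_ge0. Qed.

Lemma monotone_steep : monotone Nondecreasing steep.
Proof.
move=> S T sST; apply: lerD; first exact: monotone_excess.
by apply: ler_wpM2l => //; apply: monotone_excess.
Qed.

Lemma supermodular_steep : supermodular steep.
Proof.
move=> S T; rewrite /steep.
have := supermodular_excess k.-1 S T.
have := ler_wpM2l rho_ge0 (supermodular_excess k S T).
by rewrite !mulrDr; lra.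
Qed.

Lemma bumped_self X : #|X| = k -> bumped X X = 1.
Proof. by move=> cardX; rewrite /bumped /excess cardX subnn eqxx add0r. Qed.

Lemma steep_level S : #|S| = k -> steep S = 1.
Proof.
move=> cardS; rewrite /steep /excess cardS subnn mulr0 addr0.
by rewrite -subn1 subKn.
Qed.

(** Off [X] the [rho] terms cancel, leaving [excess k S <= excess k.-1 S]. *)
Lemma bumped_le_steep X S : S != X -> (1 + rho) * bumped X S <= steep S.
Proof.
move=> /negPf neSX; rewrite /bumped /steep neSX addr0 mulrDl mul1r lerD2r.
by rewrite ler_nat leq_sub2l // leq_pred.
Qed.

Lemma instance_swap m (f g : {set E} -> R) :
  (exists S, f S != 0) -> instance m f g -> instance m g f.
Proof.
by move=> f_neq0 [fg_ge0 [sf sg] [mf mg] _]; split=> // S; case: (fg_ge0 S).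
Qed.

(** Since [steep] does not depend on [X], only the values of [u] can reveal it. *)
Definition hard_pair o (u : {set E} -> R) :=
  if o is Minimize then (steep, u) else (u, steep).

Lemma steep_neq0 : steep setT != 0.
Proof.
rewrite gt_eqF // /steep /excess cardsT ltr_pwDl ?ltr0n ?subn_gt0 //.
  by lia.
by rewrite mulr_ge0.
Qed.

Lemma instance_hard_pair o u :
  (forall S, 0 <= u S) -> supermodular u -> monotone Nondecreasing u ->
  (exists S, u S != 0) ->
  instance Nondecreasing (hard_pair o u).1 (hard_pair o u).2.
Proof.
move=> u_ge0 su mu u_neq0.
have inst : instance Nondecreasing steep u.
  split=> // [S||]; first by split; [apply: steep_ge0 | apply: u_ge0].
    by split; first exact: supermodular_steep.
  by split; first exact: monotone_steep.
case: o => //=; apply: instance_swap inst.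
by exists setT; apply: steep_neq0.
Qed.

(** The query bound covers instances only, so the pair without the bump must be one. *)
Lemma instance_excess o :
  instance Nondecreasing (hard_pair o (excess k)).1 (hard_pair o (excess k)).2.
Proof.
apply: instance_hard_pair.
- exact: excess_ge0.
- exact: supermodular_excess.
- exact: monotone_excess.
- by exists setT; rewrite /excess cardsT pnatr_eq0 -lt0n subn_gt0.
Qed.

Lemma instance_bumped o X : #|X| = k ->
  instance Nondecreasing (hard_pair o (bumped X)).1 (hard_pair o (bumped X)).2.
Proof.
move=> cardX; apply: instance_hard_pair.
- by move=> S; rewrite addr_ge0 ?excess_ge0.
- exact: supermodular_bumped.
- exact: monotone_bumped.
- by exists X; rewrite bumped_self ?oner_eq0.
Qed.

Lemma approximates_hard_pair m o X S : #|X| = k ->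
  approximates o rho ((hard_pair o (bumped X)).1 \o orient m)
    ((hard_pair o (bumped X)).2 \o orient m) S ->
  orient m S = X.
Proof.
move=> cardX; case: (eqVneq (orient m S) X) => // neSX.
have [bX sX] := (bumped_self cardX, steep_level cardX).
have sep := bumped_le_steep neSX; have s_ge0 := steep_ge0 (orient m S).
have b_ge0 : 0 <= bumped X (orient m S) by rewrite addr_ge0 ?excess_ge0.
have uX : bumped X (orient m (orient m X)) = 1 by rewrite orientK.
have vX : steep (orient m (orient m X)) = 1 by rewrite orientK.
case: o => -[/= den_neq0 approx].
- have den_gt0 : 0 < bumped X (orient m S) by rewrite lt0r den_neq0.
  have : Defs.ratio (steep \o orient m) (bumped X \o orient m) S <= rho.
    apply: le_trans approx _; rewrite -[leRHS]mulr1 ler_wpM2l //.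
    apply: (bigmin_inf (orient m X));
      by rewrite /Defs.ratio /= uX ?vX ?divr1 ?oner_eq0.
  rewrite /Defs.ratio /= ler_pdivrMr // => /(le_trans sep).
  (* [(1 + rho) * u <= v <= rho * u] would force [u <= 0]. *)
  by rewrite mulrDl mul1r gerDr leNgt den_gt0.
- have den_gt0 : 0 < steep (orient m S) by rewrite lt0r den_neq0.
  have : rho^-1 <= Defs.ratio (bumped X \o orient m) (steep \o orient m) S.
    apply: le_trans approx; rewrite -[leLHS]mulr1 ler_wpM2l ?invr_ge0 //.
    apply: (bigmax_sup (orient m X));
      by rewrite /Defs.ratio /= vX ?uX ?divr1 ?oner_eq0.
  rewrite /Defs.ratio /= ler_pdivlMr // mulrC ler_pdivrMr // mulrC => le_s.
  (* Here [u] is the numerator; it is positive because [0 < v <= rho * u]. *)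
  have b_gt0 : 0 < bumped X (orient m S).
    by rewrite -(pmulr_rgt0 _ rho_gt0); apply: lt_le_trans le_s.
  by move: (le_trans sep le_s); rewrite mulrDl mul1r gerDr leNgt b_gt0.
Qed.

End HardInstances.

Theorem theorem1 (R : realType) (m : monotonicity) (o : objective) :
  ~ exists A : forall E : finType, algorithm R E,
      polynomially_many_queries m A /\ bounded_approximation_ratio m o A.
Proof.
case=> A [[p few_queries] [rho [rho_ge1 approx]]].
have [k k_gt0 lt_p] := poly_nat_lt_central_bin p.
pose E : finType := 'I_(k.*2).
have cardE : #|E| = k.*2 by rewrite card_ord.
have ltkE : (k < #|E|)%N by rewrite cardE; lia.
(* The factor depends on [#|E|] alone, so it is fixed before [X] is chosen. *)
pose r := rho #|E|.
have r_ge1 : 1 <= r by apply: rho_ge1.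
pose f0 := (hard_pair k r o (@excess R E k)).1 \o orient m.
pose g0 := (hard_pair k r o (@excess R E k)).2 \o orient m.
have inst0 : instance m f0 g0 by apply/instance_orient/instance_excess.
(* The returned set is included, so that [X] also differs from the answer. *)
pose seen := map (orient m) (output f0 g0 (A E) :: queries f0 g0 (A E)).
have [X cardX XNseen] : exists2 X : {set E}, #|X| = k & X \notin seen.
  have size_seen : (size seen < 'C(k.*2, k))%N.
    rewrite size_map /= size_queries; apply: leq_ltn_trans lt_p.
    by have := few_queries _ _ _ inst0; rewrite cardE.
  have /subsetPn[X] : ~~ ([set X : {set E} | #|X| == k] \subset seen).
    apply: contraL size_seen => /subset_leq_card.
    rewrite card_draws cardE => le_seen.
    by rewrite -leqNgt (leq_trans le_seen) ?card_size.
  by rewrite inE => /eqP; exists X.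
pose f := (hard_pair k r o (bumped R k X)).1 \o orient m.
pose g := (hard_pair k r o (bumped R k X)).2 \o orient m.
have inst : instance m f g by apply/instance_orient/instance_bumped.
have unseen S : S \in output f0 g0 (A E) :: queries f0 g0 (A E) ->
    orient m S != X.
  by move=> S_seen; apply: contraNneq XNseen => <-; apply: map_f.
have bump_unseen S : S \in queries f0 g0 (A E) ->
    excess R k (orient m S) = bumped R k X (orient m S).
  move=> S_query; rewrite /bumped (negPf (unseen S _)) ?addr0 //.
  by rewrite inE S_query orbT.
(* The bump was never queried, so both runs return the same set, which is not [X] up to
   orientation. *)
have eq_out : output f0 g0 (A E) = output f g (A E).
  by apply: eq_output => S /bump_unseen; rewrite /f0 /f /g0 /g; case: (o).
have := unseen _ (mem_head _ _).
rewrite eq_out.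
by rewrite (approximates_hard_pair k_gt0 r_ge1 cardX (approx _ _ _ inst)) ?eqxx.
Qed.
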